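(* Every infinite sequence of distinct posets in $W_4$ contains an infinite subsequence $P_1, P_2, \ldots$ such that $$\lim_{i\to\infty} \frac{|\mathrm{Aut}(P_i)|}{|\mathrm{End}(P_i)|} = 0.$$
   Context: All posets are finite. ''Distinct'' posets means pairwise non-isomorphic posets. An automorphism of a finite poset $P$ is an order-preserving bijection $f:P\to P$ (i.e. $a\le b$ implies $f(a)\le f(b)$); an endomorphism of $P$ is an order-preserving map $g:P\to P$, not necessarily bijective. $\mathrm{Aut}(P)$ and $\mathrm{End}(P)$ denote the sets of automorphisms and endomorphisms of $P$. A poset is graded if all its maximal (nonextendible) chains have the same length. A graded poset has a rank function $r$ with minimal elements of rank $0$ and $r(y)=r(x)+1$ whenever $y$ covers $x$. The Whitney number $w_i(P)$ is the number of elements of rank $i$ in $P$, and the whidth of $P$ is the largest of the Whitney numbers $w_i(P)$. For a positive integer $k$, $W_k$ is the set of all finite graded posets of whidth at most $k$. *)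

(* Defs.v *)
From mathcomp Require Import all_boot all_order all_fingroup.

Set Implicit Arguments.
Unset Strict Implicit.
Unset Printing Implicit Defensive.

Import Order.TTheory.

Local Open Scope order_scope.

Definition poset_iso d (P : finPOrderType d) d' (Q : finPOrderType d') : Prop :=
  exists f : P -> Q, bijective f /\ {mono f : x y / x <= y}.

Section Poset.
Context {d : Order.disp_t} (P : finPOrderType d).
Implicit Types (C : {set P}) (r : P -> nat).

Definition order_preserving (f : P -> P) : bool :=
  [forall x, forall y, (x <= y) ==> (f x <= f y)].

Definition poset_Aut : {set {perm P}} :=
  [set s : {perm P} | order_preserving s].

Definition poset_End : {set {ffun P -> P}} :=
  [set f : {ffun P -> P} | order_preserving f].

Definition chain C : bool := [forall x in C, forall y in C, x >=< y].

(* A chain with n + 1 elements has length n. *)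
Definition chain_length C : nat := #|C|.-1.

Definition maximal_chain C : bool := maxset chain C.

Definition graded : Prop :=
  forall C D, maximal_chain C -> maximal_chain D ->
  chain_length C = chain_length D.

Definition minimal (x : P) : bool := [forall y, ~~ (y < x)].

Definition covers (y x : P) : bool :=
  (x < y) && [forall z, ~~ ((x < z) && (z < y))].

Definition rank_function r : Prop :=
  (forall x, minimal x -> r x = 0%N) /\
  (forall x y, covers y x -> r y = (r x).+1).

Definition whitney r (i : nat) : nat := #|[set x | r x == i]|.

(* It suffices to maximize over the ranks that are attained, since the other
   Whitney numbers are 0. *)
Definition whidth r : nat := \max_(x : P) whitney r (r x).

(* The rank function of a graded poset exists and is unique: see
   [graded_rank_function] and [rank_function_unique] below. *)
Definition in_W (k : nat) : Prop :=
  graded /\ exists r, rank_function r /\ (whidth r <= k)%N.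

Lemma whitney_le_whidth r i : (whitney r i <= whidth r)%N.
Proof.
rewrite /whitney; have [->|[x]] := set_0Vmem [set x | r x == i].
  by rewrite cards0.
by rewrite inE => /eqP <-; exact: (leq_bigmax x).
Qed.

Lemma chainP C :
  reflect {in C &, forall x y, x >=< y} (chain C).
Proof.
apply: (iffP forallP) => h.
  move=> x y xC yC; move/implyP: (h x) => /(_ xC) /forallP /(_ y) /implyP; exact.
by move=> x; apply/implyP => xC; apply/forallP => y; apply/implyP => yC; exact: h.
Qed.

Lemma chainS C (D : {set P}) : C \subset D -> chain D -> chain C.
Proof.
move=> /subsetP CD /chainP h.
by apply/chainP => x y /CD xD /CD yD; exact: h.
Qed.

Let down x : {set P} := [set z | z <= x].
Let up x : {set P} := [set z | x < z].
Let chain_in (A : {set P}) : pred {set P} :=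
  [pred C | chain C && (C \subset A)].

Let maxP A C (E : {set P}) :
  maxset (chain_in A) C -> chain E -> C \subset E -> E :&: A = C.
Proof.
move=> /maxsetP[/andP[chC CA] h] chE CE; apply: h; last by rewrite subsetI CE.
by apply/andP; split; [exact: chainS (subsetIl _ _) chE | exact: subsetIr].
Qed.

Let mem_top x C : maxset (chain_in (down x)) C -> x \in C.
Proof.
move=> /maxsetP[/andP[/chainP chC /subsetP CA] h].
rewrite -(h (x |: C)) ?setU11 ?subsetUr //; apply/andP; split.
  apply/chainP => u v /setU1P[->|uC] /setU1P[->|vC]; first exact: comparablexx; last exact: chC.
  - by apply/orP; right; move: (CA _ vC); rewrite inE.
  - by apply/orP; left; move: (CA _ uC); rewrite inE.
by apply/subsetP => u /setU1P[->|/CA //]; rewrite inE.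
Qed.

Let glue x C D : maxset (chain_in (down x)) C -> maxset (chain_in (up x)) D ->
  maximal_chain (C :|: D) /\ #|C :|: D| = (#|C| + #|D|)%N.
Proof.
move=> mC mD; have xC := mem_top mC.
have /maxsetP[/andP[chC CA] _] := mC; have /maxsetP[/andP[chD DA] _] := mD.
have Cx z : z \in C -> z <= x by move/(subsetP CA); rewrite inE.
have Dx z : z \in D -> x < z by move/(subsetP DA); rewrite inE.
split.
  apply/maxsetP; split.
    apply/chainP => u v /setUP[uC|uD] /setUP[vC|vD].
    - exact: (chainP _ chC).
    - by apply/orP; left; exact: le_trans (Cx _ uC) (ltW (Dx _ vD)).
    - by apply/orP; right; exact: le_trans (Cx _ vC) (ltW (Dx _ uD)).
    - exact: (chainP _ chD).
  move=> E chE; rewrite subUset => /andP[CE DE].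
  apply/setP => e; rewrite -{1}(maxP mC chE CE) -(maxP mD chE DE) !inE.
  have [eE|] //= := boolP (e \in E).
  have := chainP _ chE _ _ eE (subsetP CE _ xC).
  rewrite comparable_leNgt; last exact: (chainP _ chE _ _ eE (subsetP CE _ xC)).
  by case: (x < e).
rewrite cardsU (_ : C :&: D = set0) ?cards0 ?subn0 //.
apply/setP => z; rewrite !inE; apply/negP => /andP[/Cx zx /Dx xz].
by have := le_lt_trans zx xz; rewrite ltxx.
Qed.

Let ex_max A : {C | maxset (chain_in A) C}.
Proof.
have [|C] := @maxset_exists _ (chain_in A) set0; last by exists C.
by apply/andP; split; [apply/chainP => x y; rewrite inE | exact: sub0set].
Qed.

Lemma graded_rank_function : graded -> exists r, rank_function r.
Proof.
move=> gr; pose c x := sval (ex_max (down x)).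
have cP x : maxset (chain_in (down x)) (c x) := svalP (ex_max (down x)).
have pos C x : maxset (chain_in (down x)) C -> (0 < #|C|)%N.
  by move/mem_top => xC; apply/card_gt0P; exists x.
have same x C : maxset (chain_in (down x)) C -> #|C| = #|c x|.
  move=> mC; have [D mD] := ex_max (up x).
  have [m1 e1] := glue mC mD; have [m2 e2] := glue (cP x) mD.
  have := gr _ _ m1 m2; rewrite /chain_length e1 e2.
  have := pos _ _ mC; have := pos _ _ (cP x).
  by case: #|c x| #|C| => // a [//|b] _ _ /= /addIn ->.
exists (fun x => #|c x|.-1); split=> [x /forallP mx|x y /andP[xy /forallP cov]].
  suff -> : c x = [set x] by rewrite cards1.
  have /maxsetP[/andP[_ /subsetP cx] _] := cP x.
  apply/setP => z; rewrite !inE; apply/idP/eqP => [/cx|->]; last exact: mem_top.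
  by rewrite inE le_eqVlt (negPf (mx z)) orbF => /eqP.
have /maxsetP[/andP[chC /subsetP CA] _] := cP x.
have cx z : z \in c x -> z <= x by move/CA; rewrite inE.
have ynx : y \notin c x by apply/negP => /cx /(lt_le_trans xy); rewrite ltxx.
rewrite -(same y (y |: c x)); first last.
  apply/maxsetP; split.
    apply/andP; split.
      apply/chainP => u v /setU1P[->|uC] /setU1P[->|vC]; first exact: comparablexx; last exact: (chainP _ chC).
      - by apply/orP; right; exact: le_trans (cx _ vC) (ltW xy).
      - by apply/orP; left; exact: le_trans (cx _ uC) (ltW xy).
    apply/subsetP => u /setU1P[->|/cx ux]; rewrite inE //.
    exact: le_trans ux (ltW xy).
  move=> E /andP[chE /subsetP Ey]; rewrite subUset sub1set => /andP[yE CE].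
  apply/setP => e; rewrite -(maxP (cP x) chE CE) !inE.
  have [->|ey] /= := eqVneq e y; first by rewrite yE.
  have [eE|] //= := boolP (e \in E).
  have xE := subsetP CE _ (mem_top (cP x)).
  rewrite comparable_leNgt ?(chainP _ chE) //.
  have := cov e; have := Ey _ eE; rewrite inE le_eqVlt (negPf ey) /= => -> .
  by rewrite andbT => ->.
by rewrite cardsU1 ynx /= ?add1n ?add0n prednK //; exact: pos (cP x).
Qed.

Lemma rank_function_unique r (r' : P -> nat) :
  rank_function r -> rank_function r' -> r =1 r'.
Proof.
move=> [m c] [m' c'] x.
have [n] := ubnP #|down x|; elim: n x => // n IH x; rewrite ltnS => xn.
have [mx|] := boolP (minimal x); first by rewrite m ?m'.
rewrite negb_forall => /existsP[y0]; rewrite negbK => y0x.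
case: (@arg_maxnP _ y0 (fun y => y < x) (fun y => #|down y|) y0x) => y yx ymax.
have lt u v : u < v -> (#|down u| < #|down v|)%N.
  move=> uv; apply: proper_card; apply/properP; split.
    by apply/subsetP => z; rewrite !inE => zu; exact: le_trans zu (ltW uv).
  by exists v; rewrite !inE // -?ltNge // lt_geF.
have cyx : covers x y.
  rewrite /covers yx; apply/forallP => z; apply/negP => /andP[yz zx].
  by have := ymax z zx; rewrite /= leqNgt lt.
rewrite (c _ _ cyx) (c' _ _ cyx) IH //.
exact: leq_trans (lt _ _ yx) xn.
Qed.

End Poset.

(* Main.v *)
Require Import Defs.
From mathcomp Require Import all_boot all_order all_fingroup all_algebra.
From mathcomp Require Import all_classical all_reals all_analysis.
From Stdlib Require BinNat Nnat.
From mathcomp Require Import zify.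
From mathcomp Require Import fintype finset bigop.

Import Order.TTheory GRing.Theory Num.Theory.
Import numFieldNormedType.Exports.

Set Implicit Arguments.
Unset Strict Implicit.
Unset Printing Implicit Defensive.

(** The number of endomorphisms is compared with that of automorphisms in two
    regimes, according to the number of movable elements of the poset: those
    [x] such that, for some [y <> x], the map that sends [x] to [y] and fixes
    everything else preserves the order.

    Composing these maps with automorphisms gives
    [#|Aut| * #|movable| <= 2 * #|End|] ([card_Aut_movable]), because such a
    composite determines both of its factors up to an ambiguity of 2. So the
    quotient [#|Aut| / #|End|] is small when there are many movable elements.

    Suppose now that there are few of them, and let [n] be the height.

    - There are at most about [24 ^ (n / 2)] automorphisms ([card_Aut_le]).
      Indeed an automorphism that fixes all elements of rank less than [k]
      permutes the level [k] and preserves the classes of elements with the same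
      down-set. Since no element of a class can be moved to another one, the
      sets of upper covers of the elements of a class form an antichain, and
      each of them is a union of classes of level [k + 1]. So
      large classes in level [k] require many, hence small, classes in level
      [k + 1], and as levels have at most four elements, two
      consecutive levels together allow at most 24 permutations
      ([level_perms_pair]).

    - There are at least about [5.83 ^ n] endomorphisms ([delannoy_End]). Every
      multichain [c_0 <= ... <= c_n] yields one, sending elements of rank [i] to
      [c_i]. Below the top rank, an element that is not movable has at
      least two upper covers, so multichains that start at a minimal element are, up
      to a bounded factor, at least as many as the paths counted by a central
      Delannoy number.

    As [5.83 ^ 2 > 24], the quotient tends to 0 when the height grows, and
    it does so uniformly: for every [K], all sufficiently large posets satisfy
    [K * #|Aut| <= #|End|] ([Aut_le_End]). Finally, only
    finitely many pairwise non-isomorphic posets have bounded size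
    ([card_eventually_ge]). *)

(** * Delannoy numbers *)

(** The Delannoy numbers, defined by summing over the height of the first step:
    [delannoy t m] counts the nondecreasing maps from [{0, ..., t}] to
    [{0, ..., m}] that send 0 to 0, each weighted by 2 to the number of its
    jumps. In this form they bound the number of multichains of length [t] in a
    poset of height [m] where every element has at least two upper covers. *)
Fixpoint delannoy (t m : nat) : nat :=
  if t is t'.+1 then delannoy t' m + 2 * \sum_(j < m) delannoy t' j else 1.

Lemma delannoy_0 t : delannoy t 0 = 1.
Proof. by elim: t => //= t ->; rewrite big_ord0. Qed.

Lemma delannoySS t m :
  delannoy t.+1 m.+1 = delannoy t.+1 m + delannoy t m.+1 + delannoy t m.
Proof. by rewrite /= big_ord_recr /=; lia. Qed.

Lemma delannoy_leqr t : {homo delannoy t : m1 m2 / m1 <= m2}.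
Proof.
apply: homo_leq => [//|? ? ?|m]; first exact: leq_trans.
by case: t => [//|t]; rewrite delannoySS -addnA leq_addr.
Qed.

Lemma delannoy_leql m : {homo delannoy^~ m : t1 t2 / t1 <= t2}.
Proof.
apply: homo_leq => [//|? ? ?|t]; first exact: leq_trans.
exact: leq_addr.
Qed.

(** [delannoy t m] is also the number of lattice paths from [(0, 0)] to [(t, m)]
    with unit steps east, north and north-east, and paths can be concatenated. *)
Lemma delannoy_super a b c d :
  delannoy a c * delannoy b d <= delannoy (a + b) (c + d).
Proof.
elim: b d => [|b IHb] d.
  by rewrite muln1 addn0 delannoy_leqr ?leq_addr.
elim: d => [|d IHd].
  by rewrite delannoy_0 muln1 addn0 delannoy_leql ?leq_addr.
have := (IHb d, IHb d.+1, IHd); rewrite !addnS !delannoySS => -[[]].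
by rewrite !mulnDr => ? ? ?; do 2?apply: leq_add.
Qed.

Lemma delannoy_pow a p : delannoy a a ^ p <= delannoy (p * a) (p * a).
Proof.
elim: p => // p IHp; rewrite expnS mulSn.
by apply: leq_trans (delannoy_super _ _ _ _); rewrite leq_mul2l IHp orbT.
Qed.

Section BinaryComputation.
Import BinNat Nnat.

(** The row of [t.+1] from the row of [t], in binary: [p] and [q] are the entries
    to the left of [s] and of the result. *)
Fixpoint delannoy_row (p q : N) (s : seq N) : seq BinNums.N :=
  if s is x :: s' then
    let y := N.add (N.add q p) x in y :: delannoy_row x y s' else [::].

Lemma delannoy_rowP t m k p q s :
  N.to_nat p = delannoy t m -> N.to_nat q = delannoy t.+1 m ->
  map N.to_nat s = [seq delannoy t i | i <- iota m.+1 k] ->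
  map N.to_nat (delannoy_row p q s) = [seq delannoy t.+1 i | i <- iota m.+1 k].
Proof.
elim: k m p q s => [|k IHk] m p q [|x s] // pE qE [xE sE].
rewrite [LHS]/= [RHS]/=; set y := N.add (N.add q p) x.
have yE : N.to_nat y = delannoy t.+1 m.+1.
  by rewrite delannoySS /y !N2Nat.inj_add pE qE xE addnAC.
by congr (_ :: _) => //; exact: (IHk m.+1).
Qed.

(** The diagonal Delannoy numbers have growth rate [3 + 2 sqrt 2], about 5.83,
    and 12 is a size at which they exceed [(sqrt 24) ^ n] by a
    factor 5/4 already; superadditivity then keeps this lead for all
    multiples of 12. *)
Lemma delannoy_12 : 5 * 24 ^ 6 <= 4 * delannoy 12 12.
Proof.
pose row t := iter t (delannoy_row 1%num 1%num) (nseq 12 1%num).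
have rowE t : map N.to_nat (row t) = [seq delannoy t i | i <- iota 1 12].
  by elim: t => // t IHt; apply: delannoy_rowP => //; rewrite delannoy_0.
have -> : delannoy 12 12 = N.to_nat (last 0%num (row 12)).
  have lastE (f : nat -> nat) : last 0 [seq f i | i <- iota 1 12] = f 12 by [].
  by rewrite -(lastE (delannoy 12)) -rowE (last_map N.to_nat _ 0%num).
have -> : last 0%num (row 12) = 251595969%num by vm_compute.
have -> : 24 ^ 6 = N.to_nat 191102976%num.
  have powE a : N.to_nat a ^ 6 = N.to_nat (iter 5 (N.mul a) a).
    by rewrite /= !N2Nat.inj_mul !multE !expnS expn0 muln1.
  by rewrite -[LHS]/(N.to_nat 24%num ^ 6) powE; apply: (congr1 N.to_nat).
lia.
Qed.

End BinaryComputation.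

(** * Counting coloured permutations and antichains *)

(** The product of the factorials of the multiplicities of the colours in [s]. *)
Fixpoint colour_fact (T : eqType) (s : seq T) : nat :=
  if s is t :: s' then (count_mem t s').+1 * colour_fact s' else 1.

Definition colour_perms (T : finType) (U : eqType) (c : T -> U) (A : {set T}) :
    {set {perm T}} :=
  [set p : {perm T} | perm_on A p & [forall x, c (p x) == c x]].

(** A colour-preserving permutation [p] of [x :: s] is determined by [p x], which
    has the colour of [x], and by the permutation of [s] obtained by
    short-circuiting [x], that is by composing [p] with the transposition of
    [x] and [p x]. *)
Lemma card_colour_perms (T : finType) (U : eqType) (c : T -> U) (A : {set T}) :
  #|colour_perms c A| <= colour_fact [seq c x | x <- enum A].
Proof.
have -> : colour_perms c A = colour_perms c [set x in enum A].
  by congr (colour_perms c _); apply/setP => x; rewrite !inE mem_enum.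
elim: (enum A) (enum_uniq A) => [|x s IHs] /= => [_|/andP[xs us]].
  rewrite -(cards1 (1 : {perm T})%g); apply/subset_leq_card/subsetP => p.
  rewrite !inE => /andP[/subsetP on _]; apply/eqP/permP => x.
  rewrite perm1; apply/eqP; apply: contraT => px.
  by have := on x; rewrite !inE => /(_ px).
pose class := [set y in x :: s | c y == c x].
pose f (p : {perm T}) := (p x, (p * tperm x (p x))%g).
have classE : #|class| = (count_mem (c x) (map c s)).+1.
  rewrite -[RHS]/(1 + _) count_map -size_filter.
  have <- : #|[set y in [seq y <- s | preim c (pred1 (c x)) y]]| =
            size [seq y <- s | preim c (pred1 (c x)) y].
    by rewrite cardsE; apply/card_uniqP; rewrite filter_uniq.
  have -> : class = x |: [set y in [seq y <- s | preim c (pred1 (c x)) y]].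
    apply/setP => y; rewrite !inE mem_filter /=.
    by have [->|] := eqVneq y x; rewrite /= ?eqxx // andbC.
  by rewrite cardsU1 inE mem_filter (negPf xs) andbF.
have f_inj : injective f.
  by move=> p q [pq /eqP]; rewrite -pq => /eqP /mulIg.
rewrite -classE -(card_imset _ f_inj).
apply: leq_trans (_ : #|setX class (colour_perms c [set y in s])| <= _).
  apply/subset_leq_card/subsetP => _ /imsetP[p pC ->].
  move: pC; rewrite inE => /andP[on /forallP cp].
  have px : p x \in x :: s.
    by have := perm_closed x on; rewrite !inE eqxx.
  rewrite !inE -in_cons px cp /=; apply/andP; split; last first.
    apply/forallP => y; rewrite permM -(eqP (cp y)).
    by case: tpermP => [->|->|]; rewrite ?(eqP (cp x)).
  apply/subsetP => y; rewrite !inE permM; apply: contraR => ys.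
  have [->|yx] := eqVneq y x; first by rewrite tpermR.
  have -> : p y = y by apply: (out_perm on); rewrite !inE negb_or yx.
  rewrite tpermD // 1?eq_sym //; apply: contraNneq ys => yE.
  by move: px; rewrite -yE inE (negPf yx).
by rewrite cardsX leq_mul2l IHs ?orbT.
Qed.

Lemma colour_fact_size (T : eqType) (s : seq T) : size s <= 4 -> colour_fact s <= 24.
Proof.
move=> s4; apply: leq_trans (_ : (size s)`! <= _); last first.
  by move: s4; do 5?[case: s => [//|? s]].
elim: s {s4} => //= t s IHs; rewrite factS leq_mul //.
by rewrite ltnS count_size.
Qed.

Lemma count_mem_undup (T : eqType) (t : T) (s : seq T) :
  count_mem t s + size (undup s) <= (size s).+1.
Proof.
rewrite -(count_predC (pred1 t) s) -addnS leq_add2l -size_filter.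
apply: (@uniq_leq_size _ _ (t :: _)) (undup_uniq s) _ => u.
by rewrite mem_undup inE mem_filter /= => ->; rewrite andbT orbN.
Qed.

(** Among at most four elements, [k] colours leave at most [4 - k] elements beyond
    one of each colour, and the product of factorials is largest when they
    all share a colour. *)
Lemma colour_fact_few_colours (T : eqType) (s : seq T) : size s <= 4 ->
  colour_fact s <= (5 - maxn 1 (size (undup s)))`!.
Proof.
have [->//|s0] := eqVneq s [::]; move=> s4.
have c0 : 0 < size (undup s).
  by rewrite lt0n size_eq0; apply: contra_neq s0 => /undup_nil.
rewrite (maxn_idPr c0).
apply: leq_trans (_ : ((size s).+1 - size (undup s))`! <= _); last first.
  by rewrite leq_fact // leq_sub2r.
elim: s {s0 s4 c0} => //= t s IHs; have := count_mem_undup t s.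
have := size_undup s; case: ifP => ts us le.
  rewrite subSn ?factS; last by rewrite ltnW.
  by rewrite leq_mul //; lia.
by rewrite subSS (count_memPn _) ?mul1n ?ts.
Qed.

(** The multiplicity bound [m] will come from the number of colours on the
    next level, whose permutations are at most [(5 - m)`!] many. *)
Lemma colour_fact_mult (T : eqType) (s : seq T) m : size s <= 4 -> 0 < m <= 3 ->
  (forall t, count_mem t s <= m) -> colour_fact s * (5 - m)`! <= 24.
Proof.
move=> s4 m3 H; have : all (fun t => count_mem t s <= m) s by apply/allP => t _.
have fE : [/\ (5 - 1)`! = 24, (5 - 2)`! = 6 & (5 - 3)`! = 2] by [].
case: fE m m3 {H} => [f1 f2 f3] [|[|[|[|m]]]] // _; rewrite (f1, f2, f3).
all: case: s s4 => [|a [|b [|c [|d [|? ?]]]]] // _.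
all: rewrite /= ?eqxx; repeat match goal with
  |- context [?x == ?y] => case: (eqVneq x y) => ?; subst; rewrite ?eqxx end => //.
Qed.

Lemma card_fibres (T U : finType) (f : T -> U) (A : {set T}) (B : {set U}) m :
  (forall x, x \in A -> f x \in B) ->
  (forall x, x \in A -> #|[set y in A | f y == f x]| <= m) -> #|A| <= m * #|B|.
Proof.
move=> fB fm; rewrite -sum1_card (partition_big f (mem B)) //=.
rewrite mulnC -sum_nat_const; apply: leq_sum => u _.
rewrite sum1dep_card; have [->|[x]] := set_0Vmem [set y in A | f y == u].
  by rewrite cards0.
by rewrite inE => /andP[xA /eqP <-]; exact: fm.
Qed.

(** Sperner's theorem for a set of at most three elements, [x] standing for the
    subset of those [t] in [ts] that contain it. The function [key] below
    assigns to [x] its block in a partition of the subsets of [{0, 1, 2}] into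
    three chains: [{}, {0}, {0, 1}, {0, 1, 2}], then [{1}, {1, 2}], then
    [{2}, {0, 2}]; the elements of an antichain have distinct keys. *)
Lemma antichain_le3 (T : finType) (ts : seq {set T}) (X : {set T}) : size ts <= 3 ->
  {in X &, forall x y, x != y -> exists2 t, t \in ts & (x \in t) && (y \notin t)} ->
  #|X| <= maxn 1 (size ts).
Proof.
move=> ts3 anti; pose b i x := x \in nth set0 ts i.
pose key x := if b 0 x && (b 1 x || ~~ b 2 x) then 0
              else if b 1 x then 1 else if b 2 x then 2 else 0.
have key_lt x : key x < maxn 1 (size ts).
  rewrite /key /b; case: ts ts3 {anti b key} => [|t1 [|t2 [|t3 [|? ?]]]] //= _;
    by rewrite ?inE; do ?case: (x \in _).
have sep x y : x \in X -> y \in X -> x != y -> exists2 i, i < 3 & b i x && ~~ b i y.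
  move=> xX yX xy; have [t tts xty] := anti _ _ xX yX xy.
  exists (index t ts); last by rewrite /b nth_index.
  by apply: leq_trans ts3; rewrite index_mem.
rewrite -[maxn _ _]card_ord.
apply: (@leq_card_in _ _ (fun x => Ordinal (key_lt x))) => x y xX yX [kxy].
apply/eqP; apply: contraT => xy.
have yx : y != x by rewrite eq_sym.
have [i i3 hi] := sep _ _ xX yX xy.
have [j j3 hj] := sep _ _ yX xX yx.
move: kxy hi hj; rewrite /key.
case: i i3 => [|[|[|]]] // _; case: j j3 => [|[|[|]]] // _;
  by do 6?[case: (b _ _)].
Qed.

(** * Rank functions of graded posets *)

Section Poset.
Context {d : Order.disp_t} (P : finPOrderType d).
Implicit Types x y z : P.

Lemma order_preservingP (f : P -> P) :
  reflect {homo f : x y / (x <= y)%O} (order_preserving f).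
Proof.
apply: (iffP forallP) => [h x y xy|h x].
  by move/forallP: (h x) => /(_ y) /implyP; exact.
by apply/forallP => y; apply/implyP => /h.
Qed.

Lemma card_down_lt x y : (x < y)%O ->
  #|[set z | (z <= x)%O]| < #|[set z | (z <= y)%O]|.
Proof.
move=> xy; apply/proper_card/properP; split.
  by apply/subsetP => z; rewrite !inE => zx; exact: le_trans zx (ltW xy).
by exists y; rewrite !inE // lt_geF.
Qed.

Lemma cover_above x y : (x < y)%O -> exists2 z, covers z x & (z <= y)%O.
Proof.
move=> xy; pose Q z := (x < z)%O && (z <= y)%O.
have Qy : Q y by rewrite /Q xy /=.
have [z /andP[xz zy] zmin] := arg_minnP (fun z => #|[set u | (u <= z)%O]|) Qy.
exists z => //; rewrite /covers xz; apply/forallP => u.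
apply/negP => /andP[xu uz]; have := card_down_lt uz.
by rewrite ltnNge zmin // /Q xu (ltW (lt_le_trans uz zy)).
Qed.

Lemma cover_below x y : (x < y)%O -> exists2 z, covers y z & (x <= z)%O.
Proof.
move=> xy; pose Q z := (x <= z)%O && (z < y)%O.
have Qx : Q x by rewrite /Q xy lexx.
have [z /andP[xz zy] zmax] := arg_maxnP (fun z => #|[set u | (u <= z)%O]|) Qx.
exists z => //; rewrite /covers zy; apply/forallP => u.
apply/negP => /andP[zu uy]; have := card_down_lt zu.
by rewrite ltnNge; apply/negP/negPn/zmax; rewrite /Q uy (ltW (le_lt_trans xz zu)).
Qed.

Lemma poset_Aut_group_set : group_set (poset_Aut P).
Proof.
apply/group_setP; split.
  by rewrite inE; apply/order_preservingP => x y; rewrite !perm1.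
move=> s t; rewrite !inE => /order_preservingP sP /order_preservingP tP.
by apply/order_preservingP => x y xy; rewrite !permM; apply/tP/sP.
Qed.

Lemma poset_Aut1 : 1%g \in poset_Aut P.
Proof. by have /group_setP[] := poset_Aut_group_set. Qed.

Lemma poset_AutM s t :
  s \in poset_Aut P -> t \in poset_Aut P -> (s * t)%g \in poset_Aut P.
Proof. by have /group_setP[_ H] := poset_Aut_group_set; exact: H. Qed.

Lemma poset_AutV s : s \in poset_Aut P -> (s^-1)%g \in poset_Aut P.
Proof. by move=> sA; have := sA; rewrite -(groupV (Group poset_Aut_group_set)). Qed.

(** In a finite group inverses are powers, so the inverse of an order-preserving
    permutation preserves the order, and its order is also reflected. *)
Lemma poset_Aut_le s : s \in poset_Aut P -> {mono s : x y / (x <= y)%O}.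
Proof.
move=> sA x y; have := poset_AutV sA; move: sA; rewrite !inE.
move=> /order_preservingP sP /order_preservingP sVP.
by apply/idP/idP => [/sVP|/sP //]; rewrite !permK.
Qed.

Lemma poset_Aut_lt s : s \in poset_Aut P -> {mono s : x y / (x < y)%O}.
Proof. by move/poset_Aut_le => h x y; rewrite !lt_neqAle h (inj_eq perm_inj). Qed.

Context (r : P -> nat) (rk : rank_function r).

Lemma rank_lt x y : (x < y)%O -> r x < r y.
Proof.
have [m] := ubnP #|[set z | (z <= y)%O]|; elim: m y => // m IH y; rewrite ltnS => ym xy.
have [z zy xz] := cover_below xy; rewrite (rk.2 _ _ zy) ltnS.
move: xz; rewrite le_eqVlt => /predU1P[->//|xz]; apply/ltnW/IH => //.
by apply: leq_trans ym; apply: card_down_lt; case/andP: zy.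
Qed.

Lemma rank_le x y : (x <= y)%O -> r x <= r y.
Proof. by rewrite le_eqVlt => /predU1P[->//|/rank_lt/ltnW]. Qed.

(** An automorphism turns the rank function into a rank function, and there is
    only one. *)
Lemma rank_Aut s : s \in poset_Aut P -> forall x, r (s x) = r x.
Proof.
move=> sA; apply: rank_function_unique rk; have sV := poset_AutV sA.
split=> [x /forallP mx|x y /andP[xy /forallP cxy]].
  apply: rk.1; apply/forallP => y; rewrite -(permKV s y) poset_Aut_lt //; exact: mx.
apply: rk.2; rewrite /covers poset_Aut_lt // xy; apply/forallP => z.
by rewrite -(permKV s z) !poset_Aut_lt.
Qed.

Definition height : nat := \max_x r x.

Lemma rank_height x : r x <= height.
Proof. exact: (leq_bigmax x). Qed.

Context (gr : graded P).

Lemma chain_below y :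
  exists2 C : {set P}, chain C & #|C| = (r y).+1 /\ forall z, z \in C -> (z <= y)%O.
Proof.
have [m] := ubnP (r y); elim: m y => // m IH y; rewrite ltnS => ym.
have [my|] := boolP (minimal y).
  exists [set y]; first by apply/chainP => u v /set1P-> /set1P->; exact: comparablexx.
  by rewrite cards1 rk.1 //; split=> // z /set1P->.
rewrite negb_forall => /existsP[x]; rewrite negbK => /cover_below[z zy _].
have [|C /chainP chC [cC Cz]] := IH z; first by rewrite -(rk.2 _ _ zy).
have ltzy : (z < y)%O by case/andP: zy.
have yC : y \notin C by apply/negP => /Cz; rewrite lt_geF.
exists (y |: C).
  apply/chainP => u v /setU1P[->|uC] /setU1P[->|vC]; first exact: comparablexx.
  - by apply/orP; right; exact: le_trans (Cz _ vC) (ltW ltzy).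
  - by apply/orP; left; exact: le_trans (Cz _ uC) (ltW ltzy).
  - exact: chC.
rewrite cardsU1 yC cC (rk.2 _ _ zy); split=> // u /setU1P[->//|/Cz uz].
exact: le_trans uz (ltW ltzy).
Qed.

(** This is where gradedness enters: a maximal element of smaller rank would be
    the top of a maximal chain shorter than one through an element of top rank. *)
Lemma below_height x : r x < height -> exists y, (x < y)%O.
Proof.
move=> xh; suff /existsP : [exists y, (x < y)%O] by [].
apply: contraT; rewrite negb_exists => /forallP xmax.
have [y hy] : exists y, r y = height.
  by have [|y hy] := @bigop.eq_bigmax _ r; [by apply/card_gt0P; exists x | by exists y].
have ext C : chain C -> exists2 D, maximal_chain D & C \subset D.
  by move=> /maxset_exists[D]; exists D.
have [C mC xC] : exists2 C, maximal_chain C & [set x] \subset C.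
  by apply/ext/chainP => u v /set1P-> /set1P->; exact: comparablexx.
(* [D] is at least as long as a chain of [height.+1] elements below [y]. *)
have [C' /ext[D mD C'D] [cC' _]] := chain_below y.
have := gr mC mD; rewrite /chain_length; rewrite sub1set in xC.
have /chainP chC : chain C by case/maxsetP: mC.
have Cx z : z \in C -> (z <= x)%O.
  move=> zC; have := chC _ _ zC xC; rewrite /Order.comparable.
  by case/orP => [//|]; rewrite le_eqVlt (negPf (xmax z)) orbF => /eqP <-.
have cD : height.+1 <= #|D| by rewrite -hy -cC' subset_leq_card.
have : #|C| <= (r x).+1.
  rewrite -[(r x).+1]card_ord.
  apply: (@leq_card_in _ _ (fun z => inord (r z) : 'I_(r x).+1)) => u v uC vC.
  move/(congr1 val); rewrite /= !inordK ?ltnS ?rank_le ?Cx // => uv.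
  have := chC _ _ uC vC; rewrite /Order.comparable !le_eqVlt.
  by case/orP => /predU1P[->//|/rank_lt]; rewrite uv ltnn.
have : 0 < #|C| by apply/card_gt0P; exists x.
by move=> *; lia.
Qed.

Lemma cover_rank x : r x < height -> exists2 y, (x < y)%O & r y = (r x).+1.
Proof.
case/below_height => y /cover_above[z zx _]; exists z; first by case/andP: zx.
exact: rk.2.
Qed.

Lemma above_rank x j : r x <= j <= height -> exists2 y, (x <= y)%O & r y = j.
Proof.
elim: j => [|j IHj]; first by rewrite leqn0 => /andP[/eqP]; exists x.
rewrite leq_eqVlt => /andP[/predU1P[xj _|xj jh]]; first by exists x.
have [|y xy yj] := IHj; first by rewrite -ltnS xj ltnW.
have [|z yz zj] := @cover_rank y; first by rewrite yj.
by exists z; [exact: le_trans xy (ltW yz) | rewrite zj yj].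
Qed.

(** * Elements that can be moved alone *)

(** Sending [x] to [y] and fixing everything else is then an endomorphism. Both
    irreducible elements [x], with [y] their unique upper or lower cover, and
    elements [x] dominated by another element [y] of the same rank are of this
    kind. *)
Definition movable_to x y : bool :=
  (y != x) && [forall z, ((z < x)%O ==> (z <= y)%O) && ((x < z)%O ==> (y <= z)%O)].

Definition movable : {set P} := [set x | [exists y, movable_to x y]].

Definition move x y : P -> P := fun z => if z == x then y else z.

Lemma movable_toP x y :
  reflect [/\ y != x, forall z, (z < x)%O -> (z <= y)%O
            & forall z, (x < z)%O -> (y <= z)%O] (movable_to x y).
Proof.
apply: (iffP andP) => [[yx /forallP h]|[yx h1 h2]].
  split=> // z hz; have /andP[/implyP h1 /implyP h2] := h z; [exact: h1 | exact: h2].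
split=> //; apply/forallP => z; apply/andP.
by split; apply/implyP; [exact: h1 | exact: h2].
Qed.

Lemma move_le x y : movable_to x y -> {homo move x y : u v / (u <= v)%O}.
Proof.
case/movable_toP => yx down up u v uv; rewrite /move.
case: (eqVneq u x) (eqVneq v x) uv => [->|ux] [->|vx] //; rewrite le_eqVlt.
  by rewrite eq_sym (negPf vx) => /up.
by rewrite (negPf ux) => /down.
Qed.

(** The only pair of elements identified by [move x y] is [{x, y}]. *)
Lemma move_eq x y x' y' : x != y -> x' != y' ->
  (forall u v, (move x y u == move x y v) = (move x' y' u == move x' y' v)) ->
  (x = x' /\ y = y') \/ (x = y' /\ y = x').
Proof.
move=> xy xy' h; have /esym := h x y; rewrite {3 4}/move eqxx.
rewrite [y == x]eq_sym (negPf xy) eqxx /move.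
case: (eqVneq x x') (eqVneq y x') => [xx|xx] [yx|yx].
- by rewrite xx yx eqxx in xy.
- by move/eqP; left.
- by move/eqP; right.
- by rewrite (negPf xy).
Qed.

(** Composing the move of [x] with an automorphism gives an endomorphism that
    remembers almost everything: the pair it identifies is [x] and its
    target, one bit tells which of the two is [x], and the automorphism is then
    known outside [x], hence everywhere. *)
Lemma card_Aut_movable : #|poset_Aut P| * #|movable| <= #|poset_End P| * 2.
Proof.
pose to x := odflt x [pick y | movable_to x y].
have toP x : x \in movable -> movable_to x (to x).
  by rewrite inE /to => /existsP[y xy]; case: pickP => [//|/(_ y)]; rewrite xy.
pose f (u : {perm P} * P) : {ffun P -> P} * bool :=
  ([ffun z => u.1 (move u.2 (to u.2) z)], enum_rank u.2 < enum_rank (to u.2)).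
have f_in : f @: setX (poset_Aut P) movable \subset setX (poset_End P) setT.
  apply/subsetP => _ /imsetP[[s x] /setXP[/= sA xm] ->].
  rewrite in_setX in_setT andbT inE; apply/order_preservingP => u v uv.
  by rewrite !ffunE poset_Aut_le // move_le // toP.
have f_inj : {in setX (poset_Aut P) movable &, injective f}.
  move=> [s x] [t y] /setXP[/= sA xm] /setXP[/= tA ym] [/ffunP fE].
  have {}fE z : s (move x (to x) z) = t (move y (to y) z).
    by have := fE z; rewrite !ffunE.
  have /movable_toP[tx _ _] := toP _ xm; have /movable_toP[ty _ _] := toP _ ym.
  have [||u v|[xy _]|[xE yE]] := @move_eq x (to x) y (to y); rewrite 1?eq_sym //.
  - by rewrite -(inj_eq (@perm_inj _ s)) !fE (inj_eq perm_inj).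
  - move=> _; rewrite -xy in fE ty *; congr (_, _).
    have st z : z != x -> s z = t z.
      by move=> zx; have := fE z; rewrite /move (negPf zx).
    apply/permP => z; have [->|/st//] := eqVneq z x.
    have := permKV s (t x); set w := (s^-1)%g (t x) => sw.
    have [wx|wx] := eqVneq w x; first by rewrite -sw wx.
    by move: (wx); rewrite -(inj_eq (@perm_inj _ t)) -(st w wx) sw eqxx.
  - rewrite yE -xE; case: ltngtP => // /val_inj /enum_rank_inj xy _.
    by rewrite yE xy eqxx in tx.
rewrite -cardsX -(card_in_imset f_inj).
by apply: leq_trans (subset_leq_card f_in) _; rewrite cardsX cardsT card_bool.
Qed.

(** * Multichains and endomorphisms *)

(** If [x] had a unique upper cover [y], it could be moved to [y]. *)
Lemma two_covers x : r x < height -> x \notin movable ->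
  exists y z, [/\ y != z, (x < y)%O, (x < z)%O, r y = (r x).+1 & r z = (r x).+1].
Proof.
move=> xh xm; have [y xy ry] := cover_rank xh.
suff /existsP[z /andP[xz yz]] : [exists z, (x < z)%O && ~~ (y <= z)%O].
  have [w wx wz] := cover_above xz; exists y, w.
  rewrite ry (rk.2 _ _ wx) xy; split=> //; last by case/andP: wx.
  by apply: contraNneq yz => ->.
apply: contraNT xm; rewrite negb_exists => /forallP h.
rewrite inE; apply/existsP; exists y; apply/movable_toP.
split=> [|z zx|z xz]; first by rewrite gt_eqF.
  exact: ltW (lt_trans zx xy).
by have := h z; rewrite xz negbK.
Qed.

Fixpoint multichains t x : seq (seq P) :=
  if t is t'.+1 then
    [seq y :: s | y <- enum [pred y | (x <= y)%O], s <- multichains t' y]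
  else [:: [::]].

Lemma size_multichainsS t x :
  size (multichains t.+1 x) = \sum_(y | (x <= y)%O) size (multichains t y).
Proof. by rewrite /= size_allpairs_dep sumnE big_map big_enum. Qed.

Lemma multichainsP t x s : s \in multichains t x -> size s = t /\ path <=%O x s.
Proof.
elim: t x s => [|t IHt] x s /=; first by rewrite inE => /eqP->.
case/allpairsPdep => y [s' [+ /IHt[<- ps'] ->]].
by rewrite mem_enum inE /= => ->.
Qed.

Lemma multichains_uniq t x : uniq (multichains t x).
Proof.
elim: t x => //= t IHt x; apply: allpairs_uniq_dep => [|//|]; first exact: enum_uniq.
by move=> [? ?] [? ?] _ _ /= [-> ->].
Qed.

(** A multichain [x = c_0 <= c_1 <= ...] as long as the height defines the
    endomorphism sending an element of rank [i] to [c_i]. *)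
Lemma multichains_End x : r x = 0 -> size (multichains height x) <= #|poset_End P|.
Proof.
move=> rx; pose f s := [ffun z => nth x (x :: s) (r z)] : {ffun P -> P}.
have f_inj : {in multichains height x &, injective f}.
  move=> s t /multichainsP[ss _] /multichainsP[st _] /ffunP fE.
  suff [] : x :: s = x :: t by [].
  apply: (@eq_from_nth _ x); rewrite /= ss ?st // => i ih.
  have [|z _ <-] := @above_rank x i; first by rewrite rx -ltnS.
  by have := fE z; rewrite !ffunE.
rewrite -(size_map f) cardE; apply: uniq_leq_size.
  by rewrite map_inj_in_uniq // multichains_uniq.
move=> _ /mapP[s /multichainsP[ss ps] ->]; rewrite mem_enum inE.
apply/order_preservingP => u v uv; rewrite !ffunE.
apply: (sorted_leq_nth le_trans le_refl) => //; last exact: rank_le.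
  by rewrite inE /= ss ltnS rank_height.
by rewrite inE /= ss ltnS rank_height.
Qed.

Definition movable_above k := #|[set x in movable | k <= r x]|.

Lemma movable_above_lt x j : x \in movable -> r x < j ->
  movable_above j < movable_above (r x).
Proof.
move=> xm xj; apply/proper_card/properP; split.
  apply/subsetP => z; rewrite !inE => /andP[-> jz]; exact: ltnW (leq_trans xj jz).
by exists x; rewrite inE xm ?leqnn // leqNgt xj.
Qed.

Lemma movable_above_le : {homo movable_above : i j /~ i <= j}.
Proof.
move=> i j ij; apply/subset_leq_card/subsetP => z; rewrite !inE => /andP[-> iz].
exact: leq_trans ij iz.
Qed.

(** Some element [y >= x] lies just below the level [j]. If [y] is not
    movable, it has two covers in that level. If it is movable, there may be only
    one, but then the exponent for level [j] misses [y] and is smaller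
    than the one for [x], which makes up for the factor 2. *)
Lemma sum_above_rank (F : P -> nat) m x j : r x < j <= height ->
  (forall y, r y = j -> m <= F y * 2 ^ movable_above j) ->
  2 * m <= (\sum_(y | (x < y)%O && (r y == j)) F y) * 2 ^ movable_above (r x).
Proof.
case: j => // j /andP[xj jh] Fm; have [|y xy yj] := @above_rank x j.
  by rewrite -ltnS xj ltnW.
have yh : r y < height by rewrite yj.
have [ym|ym] := boolP (y \in movable).
  have [z yz zj] := cover_rank yh; rewrite yj in zj.
  rewrite (bigD1 z) /=; last by rewrite zj eqxx (le_lt_trans xy yz).
  rewrite mulnDl; apply: leq_trans (leq_addr _ _).
  have lt : movable_above j.+1 < movable_above (r x).
    apply: leq_trans (movable_above_le (rank_le xy)).
    by apply: movable_above_lt ym _; rewrite yj.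
  apply: leq_trans (_ : 2 * (F z * 2 ^ movable_above j.+1) <= _).
    by rewrite leq_mul2l Fm.
  by rewrite mulnCA -expnS leq_mul2l leq_exp2l ?lt ?orbT.
have [z [w [zw yz yw rz rw]]] := two_covers yh ym; rewrite yj in rz rw.
rewrite (bigD1 z) /=; last by rewrite rz eqxx (le_lt_trans xy yz).
rewrite (bigD1 w) /=; last by rewrite rw eqxx (le_lt_trans xy yw) eq_sym.
have le : movable_above j.+1 <= movable_above (r x) by apply/movable_above_le/ltnW.
have h v : r v = j.+1 -> m <= F v * 2 ^ movable_above (r x).
  by move/Fm/leq_trans; apply; rewrite leq_mul2l leq_exp2l ?le ?orbT.
rewrite addnA mulnDl; apply: leq_trans (leq_addr _ _).
by rewrite mul2n -addnn mulnDl leq_add ?h.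
Qed.

(** The first step of a multichain either stays at [x] or goes to one of the
    levels above, which is the recursion that defines [delannoy], each movable
    element costing at most a factor 2. *)
Lemma multichains_delannoy t x :
  delannoy t (height - r x) <= size (multichains t x) * 2 ^ movable_above (r x).
Proof.
elim: t x => [|t IHt] x; first by rewrite mul1n expn_gt0.
rewrite size_multichainsS (bigD1 x) //= mulnDl leq_add ?IHt //.
rewrite (eq_bigl (fun y => (x < y)%O)); last by move=> y; rewrite lt_neqAle andbC eq_sym.
have sub y : (x < y)%O -> height - r y < height - r x.
  by move=> xy; rewrite ltn_sub2l ?rank_lt // (leq_trans (rank_lt xy)) ?rank_height.
(* The elements above [x] are sorted by their corank. *)
rewrite [in leqRHS](partition_big (fun y => inord (height - r y) : 'I_height.+1)
  (fun j => j < height - r x)) /=; last first.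
  by move=> y xy; rewrite inordK ?sub // ltnS leq_subr.
rewrite (big_ord_widen height.+1 (delannoy t)); last by rewrite leqW ?leq_subr.
rewrite big_distrr big_distrl /=; apply: leq_sum => j jx.
have jh : j <= height by rewrite -ltnS.
rewrite (eq_bigl (fun y => (x < y)%O && (r y == height - j))); last first.
  move=> y; case: (x < y)%O => //=; rewrite -val_eqE /= inordK ?ltnS ?leq_subr //.
  by have := rank_height y; lia.
apply: sum_above_rank => [|y yj]; first by lia.
by have := IHt y; rewrite yj subKn.
Qed.

Lemma delannoy_End x : delannoy height height <= #|poset_End P| * 2 ^ #|movable|.
Proof.
have [x0 rx0] : exists x0, r x0 = 0.
  have [m] := ubnP (r x); elim: m x => // m IH x; rewrite ltnS => xm.
  have [/rk.1|] := boolP (minimal x); first by exists x.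
  rewrite negb_forall => /existsP[y]; rewrite negbK => /rank_lt yx.
  by apply: (IH y); exact: leq_trans yx xm.
have := multichains_delannoy height x0; rewrite rx0 subn0 => /leq_trans; apply.
rewrite leq_mul ?multichains_End // leq_exp2l //.
by apply/subset_leq_card/subsetP => z; rewrite inE => /andP[].
Qed.

(** * Automorphisms level by level *)

Definition level k : {set P} := [set x | r x == k].
Definition down x : {set P} := [set z | (z < x)%O].

(** The colour of an element is the set of elements below it. *)
Definition level_perms k := colour_perms down (level k).

Definition Aut_fixing k : {set {perm P}} :=
  [set s in poset_Aut P | [forall x, (r x < k) ==> (s x == x)]].

Lemma Aut_fixingP k s :
  reflect (s \in poset_Aut P /\ forall x, r x < k -> s x = x) (s \in Aut_fixing k).
Proof.
rewrite [s \in Aut_fixing k]inE; apply: (iffP andP) => -[sA h]; split=> //.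
  by move=> x xk; apply/eqP; move/forallP: h => /(_ x) /implyP; exact.
by apply/forallP => x; apply/implyP => /h ->.
Qed.

(** An automorphism that fixes all lower ranks fixes the down-set of every element
    of rank [k], so it induces on the level [k] one of [level_perms k]; two automorphisms that
    induce the same permutation differ by one that fixes the level [k] too. *)
Lemma card_Aut_fixing k :
  #|Aut_fixing k| <= #|level_perms k| * #|Aut_fixing k.+1|.
Proof.
have N u : u \in poset_Aut P -> u \in ('N(level k | 'P))%g.
  by move=> uA; apply/astabsP => y; rewrite /= apermE !inE rank_Aut.
rewrite mulnC; apply: (card_fibres (f := restr_perm (level k))) => s /Aut_fixingP[sA sk].
  rewrite inE restr_perm_on; apply/forallP => x.
  have [xk|xk] := boolP (x \in level k); last by rewrite (out_perm (restr_perm_on _ _)).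
  rewrite restr_permE ?N //; apply/eqP/setP => z; rewrite !inE.
  move: xk; rewrite inE => /eqP xk.
  apply/idP/idP => zx.
    rewrite -(poset_Aut_lt sA) sk // -xk -(rank_Aut sA x); exact: rank_lt.
  rewrite -(sk z) ?poset_Aut_lt // -xk; exact: rank_lt.
rewrite -(card_imset _ (mulIg s^-1)%g); apply/subset_leq_card/subsetP.
move=> _ /imsetP[t tP ->]; case/setIdP: tP => /Aut_fixingP[tA tk] /eqP st.
apply/Aut_fixingP; split; first exact/poset_AutM/poset_AutV.
move=> x; rewrite ltnS leq_eqVlt => /predU1P[xk|xk]; last first.
  by rewrite permM tk //; apply: (canLR (permK s)); rewrite sk.
have xl : x \in level k by rewrite inE xk.
rewrite permM -(restr_permE (N _ tA) xl) st restr_permE ?N //; exact: permK.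
Qed.

Lemma Aut_fixing0 : Aut_fixing 0 = poset_Aut P.
Proof. by apply/setP => s; apply/Aut_fixingP/idP => [[]|]. Qed.

Lemma Aut_fixing_height k : height < k -> Aut_fixing k = [set 1%g].
Proof.
move=> hk; apply/setP => s; rewrite in_set1; apply/Aut_fixingP/eqP => [[_ h]|->].
  by apply/permP => x; rewrite perm1 h // (leq_ltn_trans (rank_height x)).
by split=> [|x _]; [exact: poset_Aut1 | rewrite perm1].
Qed.

Lemma card_Aut_levels m :
  #|poset_Aut P| <= (\prod_(i < m) #|level_perms i|) * #|Aut_fixing m|.
Proof.
elim: m => [|m IHm]; first by rewrite big_ord0 mul1n Aut_fixing0.
rewrite big_ord_recr /= -mulnA; apply: leq_trans IHm _.
by rewrite leq_mul2l card_Aut_fixing orbT.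
Qed.

Context (wd : whidth r <= 4).

Lemma card_level k : #|level k| <= 4.
Proof. exact: leq_trans (whitney_le_whidth r k) wd. Qed.

(** If [x] and [y] have the same elements below, some upper cover [w] of [x] is not
    above [y], as otherwise [x] could be moved to [y]. What matters about [w]
    is its down-set only, so the elements of a colour class of
    level [k] form an antichain of sets of colours of level [k.+1]. *)
Lemma twin_antichain k x y : x \in level k -> x \notin movable -> x != y ->
  down x = down y -> exists2 t, t \in [seq down z | z <- enum (level k.+1)] &
    (x \in t) && (y \notin t).
Proof.
rewrite inE => /eqP xk xm xy dxy.
have /existsP[z /andP[xz yz]] : [exists z, (x < z)%O && ~~ (y <= z)%O].
  apply: contraNT xm; rewrite negb_exists => /forallP h.
  rewrite inE; apply/existsP; exists y; apply/movable_toP.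
  split=> [|z zx|z xz]; first by rewrite eq_sym.
    by move/setP: dxy => /(_ z); rewrite !inE zx => /esym/ltW.
  by have := h z; rewrite xz negbK.
have [w wx wz] := cover_above xz; exists (down w).
  by apply: map_f; rewrite mem_enum inE (rk.2 _ _ wx) xk.
rewrite !inE; case/andP: wx => -> _ /=; apply: contra yz => yw.
exact: ltW (lt_le_trans yw wz).
Qed.

Lemma card_level_perms k : #|level_perms k| <= 24.
Proof.
apply: leq_trans (card_colour_perms _ _) _; apply: colour_fact_size.
by rewrite size_map -cardE card_level.
Qed.

(** Let [c] be the number of colours of level [k.+1]. Many colours leave little
    room for permutations of level [k.+1]; few colours leave little room for
    antichains, so that the colour classes of level [k] are small. The
    bound 24 is attained when both levels have four elements, those of level
    [k] have the same elements below and the relation between the two levels is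
    the complement of a matching. *)
Lemma level_perms_pair k : [disjoint level k & movable] ->
  #|level_perms k| * #|level_perms k.+1| <= 24.
Proof.
move=> dis; set c := undup [seq down z | z <- enum (level k.+1)].
have sz i : size [seq down x | x <- enum (level i)] <= 4.
  by rewrite size_map -cardE card_level.
have le1 := leq_trans (card_colour_perms _ _) (colour_fact_few_colours (sz k.+1)).
have [c3|c4] := leqP (size c) 3; last first.
  have c1 : maxn 1 (size c) = size c by apply/maxn_idPr; lia.
  rewrite -[24]muln1 leq_mul ?card_level_perms //; apply: leq_trans le1 _.
  have : 5 - size c <= 1 by lia.
  by rewrite -/c c1; case: (5 - _) => [|[]].
have le0 := card_colour_perms down (level k).
apply: leq_trans (leq_mul le0 le1) _.
(* The colour classes of level [k] have at most [maxn 1 (size c)] elements. *)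
apply: colour_fact_mult => //; first by rewrite leq_max geq_max c3.
move=> t; rewrite count_map -size_filter.
have <- : #|[set x in level k | down x == t]| =
          size [seq x <- enum (level k) | preim down (pred1 t) x].
  rewrite -(card_uniqP (filter_uniq _ (enum_uniq _))); apply: eq_card => x.
  by rewrite inE mem_filter mem_enum andbC.
apply: antichain_le3 => // x y; rewrite !inE => /andP[xk /eqP xt] /andP[yk /eqP yt] xy.
have xl : x \in level k by rewrite inE.
have [u uk ux] := twin_antichain xl (negbT (disjointFr dis xl)) xy (etrans xt (esym yt)).
by exists u; rewrite // mem_undup.
Qed.

Lemma sum_card_level (A : {set P}) (e : nat -> nat) m : injective e ->
  \sum_(i < m) #|level (e i) :&: A| <= #|A|.
Proof.
move=> e_inj; have cE i : #|level i :&: A| = \sum_(x in A) (if r x == i then 1 else 0).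
  rewrite -big_mkcondr sum1dep_card; apply: eq_card => x.
  by rewrite !inE andbC.
rewrite (eq_bigr _ (fun (i : 'I_m) _ => cE (e i))) -[leqRHS]sum1_card.
rewrite exchange_big /=; apply: leq_sum => x _.
rewrite -big_mkcond sum1dep_card; apply/card_le1_eqP => i j.
by rewrite !inE => /eqP-> /eqP/e_inj/val_inj.
Qed.

(** Levels are taken two by two; a pair whose lower level contains a movable
    element may contribute [24 * 24] instead of 24. *)
Lemma card_Aut_le : #|poset_Aut P| <= 24 ^ (height./2.+1 + #|movable|).
Proof.
set q := height./2.+1; have hq : height < q.*2 by rewrite /q; lia.
apply: leq_trans (card_Aut_levels q.*2) _.
rewrite Aut_fixing_height // cards1 muln1.
have pairE (F : nat -> nat) m : \prod_(i < m.*2) F i = \prod_(i < m) (F i.*2 * F i.*2.+1).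
  by elim: m => [|m IHm]; rewrite ?big_ord0 // doubleS !big_ord_recr /= IHm mulnA.
rewrite (pairE (fun i => #|level_perms i|)).
apply: leq_trans (_ : \prod_(i < q) 24 ^ (1 + #|level i.*2 :&: movable|) <= _).
  apply: leq_prod => i _; rewrite expnD expn1.
  have [e|ne] := eqVneq (level i.*2 :&: movable) set0.
    rewrite e cards0 muln1; apply: level_perms_pair.
    by rewrite -setI_eq0 e.
  apply: leq_trans (_ : 24 * 24 <= _); first by rewrite leq_mul ?card_level_perms.
  by rewrite leq_mul2l /= -{1}[24]expn1 leq_exp2l // card_gt0.
rewrite -expn_sum leq_exp2l // big_split /= sum_nat_const card_ord muln1 leq_add2l.
by apply: sum_card_level => i j; lia.
Qed.
End Poset.

(** * Comparing the two growth rates *)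

(** Bernoulli's inequality for [(5 / 4) ^ p], without denominators. *)
Lemma bernoulli_5_4 p : 4 ^ p * (4 + p) <= 4 * 5 ^ p.
Proof. by elim: p => // p IHp; rewrite !expnS; nia. Qed.

Lemma card_le_height d (P : finPOrderType d) (r : P -> nat) :
  whidth r <= 4 -> #|P| <= 4 * (height r).+1.
Proof.
move=> wd; rewrite -cardsT -[(height r).+1]card_ord -cardsT.
apply: (card_fibres (f := fun x => inord (r x) : 'I_(height r).+1)) => [x|x _].
  by rewrite inE.
apply: leq_trans (leq_trans (whitney_le_whidth r (r x)) wd).
apply/subset_leq_card/subsetP => y; rewrite !inE /= => /eqP/(congr1 val).
by rewrite /= !inordK ?ltnS ?rank_height // => ->.
Qed.

(** With at least [2 * K] movable elements, [card_Aut_movable] suffices. With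
    fewer, they only affect the bounds on automorphisms and endomorphisms by a
    bounded factor, which the quotient [(5 / 4) ^ (height / 12)] of
    the growth rates eventually exceeds. *)
Lemma Aut_le_End (K : nat) : exists M, forall d (P : finPOrderType d),
  in_W P 4 -> M <= #|P| -> K * #|poset_Aut P| <= #|poset_End P|.
Proof.
(* [C] is [K] times the factor lost to fewer than [2 * K] movable elements and to
   rounding the height down to [12 * p]; Bernoulli asks for [p >= 4 * C]. *)
pose C := 2 ^ (2 * K) * (K * 24 ^ (2 * K + 7)).
exists (4 * (12 * (4 * C)).+1) => d P [gr [r [rk wd]]] PM.
have hC : 12 * (4 * C) <= height r.
  by rewrite -ltnS -(leq_pmul2l (_ : 0 < 4)) // (leq_trans PM) // card_le_height.
have [x _] : exists x : P, x \in P.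
  by apply/card_gt0P; apply: leq_trans PM; rewrite muln_gt0.
have [mK|mK] := leqP (2 * K) #|movable P|.
  rewrite -(leq_pmul2r (_ : 0 < 2)) // mulnAC [K * 2]mulnC mulnC.
  by apply: leq_trans (card_Aut_movable P); rewrite leq_mul2l mK orbT.
set h := height r in hC; set m := #|movable P| in mK.
pose p := h %/ 12.
have pC : 4 * C <= p by rewrite leq_divRL // mulnC.
have hp : h./2.+1 + m <= 6 * p + (2 * K + 7).
  have : h < (12 * p + 12) by rewrite /p; lia.
  lia.
have Aut_up : #|poset_Aut P| <= 24 ^ (6 * p) * 24 ^ (2 * K + 7).
  rewrite -expnD; apply: leq_trans (card_Aut_le rk wd) _.
  by rewrite leq_exp2l.
have End_low : 5 ^ p * 24 ^ (6 * p) <= 4 ^ p * (#|poset_End P| * 2 ^ (2 * K)).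
  have pow_le a b q : a <= b -> a ^ q <= b ^ q by case: q => // q; rewrite leq_exp2r.
  rewrite expnM -expnMn; apply: leq_trans (pow_le _ _ p delannoy_12) _.
  rewrite expnMn leq_mul2l; apply/orP; right.
  apply: leq_trans (delannoy_pow 12 p) _.
  apply: leq_trans (_ : delannoy h h <= _).
    have ph : p * 12 <= h by exact: leq_trunc_div.
    exact: leq_trans (delannoy_leql _ ph) (delannoy_leqr _ ph).
  apply: leq_trans (delannoy_End rk gr x) _.
  by rewrite leq_mul2l leq_exp2l // ltnW ?orbT.
have C5 : 4 ^ p * C <= 5 ^ p.
  rewrite -(leq_pmul2l (_ : 0 < 4)) //; apply: leq_trans (bernoulli_5_4 p).
  by rewrite mulnCA leq_mul2l; lia.
rewrite -(leq_pmul2l (_ : 0 < 4 ^ p * 2 ^ (2 * K))) ?muln_gt0 ?expn_gt0 //.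
rewrite -[leqRHS]mulnA [2 ^ _ * #|_|]mulnC; apply: leq_trans End_low.
apply: leq_trans (leq_mul C5 (leqnn _)).
apply: leq_trans (leq_mul (leqnn _) (leq_mul (leqnn K) Aut_up)) _.
rewrite /C; apply: eq_leq; lia.
Qed.

(** * Finitely many posets of bounded size *)

(** Otherwise [B] would hold for [#|F|.+1] distinct numbers. *)
Lemma eventually_not (F : finType) (B : pred nat) (c : nat -> F) :
  {in B &, injective c} -> exists N, forall i, N <= i -> ~~ B i.
Proof.
move=> c_inj; apply: contrapT => noN.
have next N : exists i, (N <= i) && B i.
  apply: contrapT => noi; apply: noN; exists N => i Ni.
  by apply/negP => Bi; apply: noi; exists i; rewrite Ni.
have [s [us sB ss]] : exists s, [/\ uniq s, all B s & size s = #|F|.+1].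
  elim: #|F|.+1 => [|m [s [us sB ss]]]; first by exists [::].
  have [i /andP[si Bi]] := next (\max_(j <- s) j).+1.
  exists (i :: s); rewrite /= us Bi sB ss; split=> //; rewrite andbT.
  by apply: contraL si => si; rewrite -leqNgt (@bigop.leq_bigmax_seq _ s xpredT id i).
have : size (map c s) <= #|F|.
  rewrite -(card_uniqP _) ?max_card // map_inj_in_uniq // => i j is_ js.
  by apply: c_inj; exact: (allP sB).
by rewrite size_map ss ltnn.
Qed.

(** The order of [P] transported to an initial segment of [{0, ..., S - 1}], so
    that the posets with at most [S] elements have codes in one finite type. *)
Definition order_code (S : nat) d (P : finPOrderType d) :
    'I_S.+1 * {set 'I_S * 'I_S} :=
  (inord #|P|, [set u : 'I_S * 'I_S | [exists x : P, [exists y : P,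
     [&& (x <= y)%O, val (enum_rank x) == val u.1 & val (enum_rank y) == val u.2]]]]).

Lemma order_code_iso S d (P Q : finPOrderType d) :
  #|P| <= S -> #|Q| <= S -> order_code S P = order_code S Q -> poset_iso P Q.
Proof.
move=> PS QS [/(congr1 val)]; rewrite /= !inordK // => ePQ /setP codeE.
pose f x : Q := enum_val (cast_ord ePQ (enum_rank x)).
pose g y : P := enum_val (cast_ord (esym ePQ) (enum_rank y)).
exists f; split.
  by exists g => x; rewrite /f /g enum_valK ?cast_ordK ?cast_ordKV enum_rankK.
have codeP (R : finPOrderType d) (RS : #|R| <= S) (x y : R) :
  ((widen_ord RS (enum_rank x), widen_ord RS (enum_rank y)) \in (order_code S R).2) =
  (x <= y)%O.
  rewrite inE /=; apply/existsP/idP => [[x' /existsP[y']]|xy].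
    by case/and3P=> xy /eqP/val_inj/enum_rank_inj<- /eqP/val_inj/enum_rank_inj<-.
  by exists x; apply/existsP; exists y; rewrite xy !eqxx.
have wE z : widen_ord QS (enum_rank (f z)) = widen_ord PS (enum_rank z).
  by apply: val_inj; rewrite /= /f enum_valK.
by move=> x y; rewrite -(codeP Q QS) -(codeP P PS) !wE; apply/esym/codeE.
Qed.

Lemma card_eventually_ge d (P : nat -> finPOrderType d) (S : nat) :
  (forall i j, i <> j -> ~ poset_iso (P i) (P j)) ->
  exists N, forall i, N <= i -> S <= #|P i|.
Proof.
move=> dist; have [|N hN] :=
    @eventually_not _ (fun i => #|P i| < S) (fun i => order_code S (P i)).
  move=> i j iS jS cij; apply: contrapT => /dist; apply.
  by apply: order_code_iso cij; apply: ltnW.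
by exists N => i /hN; rewrite -leqNgt.
Qed.

(** * Convergence *)

Local Open Scope classical_set_scope.
Local Open Scope ring_scope.

Theorem theorem5p1 (R : realType) (d : Order.disp_t)
    (P : nat -> finPOrderType d)
    (P_W4 : forall i, in_W (P i) 4)
    (P_distinct : forall i j, i <> j -> ~ poset_iso (P i) (P j)) :
  exists s : nat -> nat, {homo s : i j / (i < j)%N} /\
    (fun i => #|poset_Aut (P (s i))|%:R / #|poset_End (P (s i))|%:R : R)
      @ \oo --> (0 : R).
Proof.
(* The quotients of the whole sequence tend to 0. *)
exists id; split=> //; apply/cvgr0Pnorm_lt => e e0.
have [K Ke] : exists K : nat, e^-1 < K%:R.
  by exists (Num.bound e^-1); rewrite archi_boundP // invr_ge0 ltW.
have [M hM] := Aut_le_End K.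
have [N hN] := card_eventually_ge M P_distinct.
exists N => // i /= /hN Mi; have := hM _ _ (P_W4 i) Mi.
have End0 : (0 < #|poset_End (P i)|)%N.
  apply/card_gt0P; exists [ffun x => x]; rewrite inE.
  by apply/order_preservingP => x y; rewrite !ffunE.
have Aut0 : (0 < #|poset_Aut (P i)|)%N.
  by apply/card_gt0P; exists 1%g; exact: poset_Aut1.
rewrite -(ler_nat R) natrM ger0_norm ?divr_ge0 // ltr_pdivrMr ?ltr0n // => KA.
rewrite mulrC -ltr_pdivrMr //; apply: lt_le_trans KA.
by rewrite mulrC ltr_pM2r ?ltr0n.
Qed.
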